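(* A semi-Riemannian manifold with indefinite metric satisfies $R_{null}\ge0$ if and only if it satisfies $R_V\ge K(V)$. Similarly with signs reversed: it satisfies $R_{null}\le0$ if and only if it satisfies $R_V\le K(V)$.
   Context: The curvature sign convention is such that $R(v,w,v,w)$ equals the sectional curvature times $\langle v,v\rangle\langle w,w\rangle-\langle v,w\rangle^2$ on nondegenerate sections. $R_{null}\ge0$ (respectively $R_{null}\le0$) means that $R(v,x,v,x)\ge0$ (respectively $\le0$) for any null vector $x$ and nonzero vector $v$ perpendicular to $x$. $R_V\ge K(V)$ means that for every Lorentz or anti-Lorentz $3$-plane $V$ in a tangent space (i.e. every 3-dimensional subspace on which the metric has signature $(+,+,-)$ or $(+,-,-)$) there is a number $K(V)$, depending on $V$, such that $R(v,w,v,w)\ge K(V)(\langle v,v\rangle\langle w,w\rangle-\langle v,w\rangle^2)$ for all $v,w\in V$. $R_V\le K(V)$ is the same with the inequality reversed. *)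

(* Defs.v *)
From HB Require Import structures.
From mathcomp Require Import all_boot all_order all_algebra.
From mathcomp Require Import all_classical all_reals all_analysis.

Set Implicit Arguments.
Unset Strict Implicit.
Unset Printing Implicit Defensive.

Import Order.TTheory GRing.Theory Num.Theory.
Import numFieldNormedType.Exports.

Local Open Scope classical_set_scope.
Local Open Scope ring_scope.

Section Calculus.
Context {R : realType} {n : nat} {W : normedModType R}.

Definition partial (i : 'I_n) (f : 'rV[R]_n -> W) : 'rV[R]_n -> W :=
  fun x => 'D_(delta_mx 0 i) f x.

(* C^infinity on an open set U: all iterated partial derivatives exist and are
   (Fréchet) differentiable, hence continuous, at every point of U. *)
Definition smooth_on (U : set 'rV[R]_n) (f : 'rV[R]_n -> W) : Prop :=
  forall (s : seq 'I_n) (x : 'rV[R]_n),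
    U x -> differentiable (foldr partial f s) x.

End Calculus.

(* Tangent vectors are row vectors of components in a coordinate basis; a
   scalar product is given by its Gram matrix G in that basis. *)
Section ScalarProduct.
Context {R : realType} {n : nat}.
Implicit Types (G : 'M[R]_n) (v w : 'rV[R]_n) (V : {vspace 'rV[R]_n}).

Definition inner G v w : R := (v *m G *m w^T) 0 0.

Definition area2 G v w : R :=
  inner G v v * inner G w w - inner G v w ^+ 2.

Definition null_vector G v : Prop := v != 0 /\ inner G v v = 0.

(* The restriction of the scalar product to V has an orthonormal basis with
   p vectors of square +1 followed by q vectors of square -1. *)
Definition has_signature G V (p q : nat) : Prop :=
  exists b : (p + q).-tuple 'rV[R]_n,
    basis_of V b /\
    forall i j : 'I_(p + q),
      inner G (tnth b i) (tnth b j) = (-1) ^+ (p <= i)%N *+ (i == j).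

End ScalarProduct.

(* Curvature of a matrix-valued function g giving a metric in coordinates. *)
Section Curvature.
Context {R : realType} {n : nat}.
Implicit Types (g : 'rV[R]_n -> 'M[R]_n) (x a b c d : 'rV[R]_n).

(* Gamma^k_ij, the coefficients of the Levi-Civita connection. *)
Definition christoffel g (k i j : 'I_n) (x : 'rV[R]_n) : R :=
  2^-1 * \sum_(l < n) invmx (g x) k l *
    (partial i (fun y => g y j l) x +
     partial j (fun y => g y i l) x -
     partial l (fun y => g y i j) x).

(* The l-th component of
   R(d_i, d_j) d_k = nabla_i nabla_j d_k - nabla_j nabla_i d_k. *)
Definition riemann g (l i j k : 'I_n) (x : 'rV[R]_n) : R :=
  partial i (christoffel g l j k) x -
  partial j (christoffel g l i k) x +
  \sum_(m < n) (christoffel g l i m x * christoffel g m j k x -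
                christoffel g l j m x * christoffel g m i k x).

Definition riemann_op g x a b d : 'rV[R]_n :=
  \row_l \sum_(i < n) \sum_(j < n) \sum_(k < n)
     a 0 i * b 0 j * d 0 k * riemann g l i j k x.

(* R(a,b,c,d) = <R(a,b)d, c>; this is the sign for which R(v,w,v,w) is the
   sectional curvature times <v,v><w,w> - <v,w>^2. *)
Definition curvature g x a b c d : R := inner (g x) (riemann_op g x a b d) c.

End Curvature.

Record chart (R : realType) (n : nat) (M : topologicalType) := Chart {
  dom : set M ;
  coord : M -> 'rV[R]_n ;
  point : 'rV[R]_n -> M ;
  dom_open : open dom ;
  image_open : open (coord @` dom) ;
  coordK : {in dom, cancel coord point} ;
  coord_continuous : {within dom, continuous coord} ;
  point_continuous : {within coord @` dom, continuous point}
}.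

Definition transition (R : realType) (n : nat) (M : topologicalType)
  (c d : chart R n M) : 'rV[R]_n -> 'rV[R]_n := coord d \o point c.

(* A smooth n-manifold with an atlas, and a metric tensor of constant index
   given by its Gram matrices in the coordinate bases of the charts.  With row
   vectors, the differential of a map f at x is v |-> v *m 'J f x, whence the
   form of the tensor transformation law. *)
Record semiRiemannianManifold (R : realType) (n : nat) := SemiRiemannian {
  carrier :> topologicalType ;
  carrier_hausdorff : hausdorff_space carrier ;
  carrier_second_countable : @second_countable carrier ;
  atlas_index : Type ;
  atlas : atlas_index -> chart R n carrier ;
  atlas_cover : forall p : carrier, exists c, dom (atlas c) p ;
  atlas_smooth : forall c d,
    smooth_on (coord (atlas c) @` (dom (atlas c) `&` dom (atlas d)))
      (transition (atlas c) (atlas d)) ;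
  metric : atlas_index -> 'rV[R]_n -> 'M[R]_n ;
  metric_smooth : forall c,
    smooth_on (coord (atlas c) @` dom (atlas c)) (metric c) ;
  metric_sym : forall c p, dom (atlas c) p ->
    (metric c (coord (atlas c) p))^T = metric c (coord (atlas c) p) ;
  metric_tensor : forall c d p, dom (atlas c) p -> dom (atlas d) p ->
    let J := 'J (transition (atlas c) (atlas d)) (coord (atlas c) p) in
    metric c (coord (atlas c) p) =
      J *m metric d (coord (atlas d) p) *m J^T ;
  index : nat ;
  index_le : (index <= n)%N ;
  metric_signature : forall c p, dom (atlas c) p ->
    has_signature (metric c (coord (atlas c) p)) fullv (n - index) index
}.

Definition indefinite (R : realType) (n : nat)
  (M : semiRiemannianManifold R n) : Prop := (0 < index M < n)%N.

(* Tangent vectors at p range over components in every chart c around p. *)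
Section CurvatureBounds.
Context {R : realType} {n : nat} (M : semiRiemannianManifold R n).

Definition metric_at (c : atlas_index M) (p : M) : 'M[R]_n :=
  metric c (coord (atlas c) p).

Definition curvature_at (c : atlas_index M) (p : M) :=
  curvature (metric c) (coord (atlas c) p).

Definition Rnull_ge0 : Prop :=
  forall (p : M) (c : atlas_index M), dom (atlas c) p ->
  forall x v : 'rV[R]_n,
    null_vector (metric_at c p) x -> v != 0 -> inner (metric_at c p) v x = 0 ->
    0 <= curvature_at c p v x v x.

Definition Rnull_le0 : Prop :=
  forall (p : M) (c : atlas_index M), dom (atlas c) p ->
  forall x v : 'rV[R]_n,
    null_vector (metric_at c p) x -> v != 0 -> inner (metric_at c p) v x = 0 ->
    curvature_at c p v x v x <= 0.

Definition lorentz_or_antilorentz (G : 'M[R]_n) (V : {vspace 'rV[R]_n}) :=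
  has_signature G V 2 1 \/ has_signature G V 1 2.

Definition RV_ge : Prop :=
  forall (p : M) (c : atlas_index M), dom (atlas c) p ->
  forall V : {vspace 'rV[R]_n}, lorentz_or_antilorentz (metric_at c p) V ->
  exists K : R, forall v w : 'rV[R]_n, v \in V -> w \in V ->
    K * area2 (metric_at c p) v w <= curvature_at c p v w v w.

Definition RV_le : Prop :=
  forall (p : M) (c : atlas_index M), dom (atlas c) p ->
  forall V : {vspace 'rV[R]_n}, lorentz_or_antilorentz (metric_at c p) V ->
  exists K : R, forall v w : 'rV[R]_n, v \in V -> w \in V ->
    curvature_at c p v w v w <= K * area2 (metric_at c p) v w.

End CurvatureBounds.

(* Main.v *)
Require Import Defs.
From HB Require Import structures.
From mathcomp Require Import all_boot all_order all_algebra.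
From mathcomp Require Import all_classical all_reals all_analysis.
From mathcomp Require Import ring lra.

Set Implicit Arguments.
Unset Strict Implicit.
Unset Printing Implicit Defensive.

Import Order.TTheory GRing.Theory Num.Theory.
Import numFieldNormedType.Exports.

Local Open Scope classical_set_scope.
Local Open Scope ring_scope.

(* At a point, R(v,w,v,w) is a quadratic form in v /\ w, because the curvature
   tensor is skew in its first and in its last two arguments.  On a Lorentz or
   anti-Lorentz 3-plane every bivector is decomposable, and those on which the
   area form vanishes are exactly the multiples of x /\ v with x null and v
   perpendicular to x.  So R_null >= 0 says that one quadratic form in three
   variables is nonnegative where an indefinite one vanishes, which by the
   S-lemma (Finsler) gives the multiplier K(V).  Conversely, a null x and a
   nonnull v perpendicular to x span, with a second null vector, such a 3-plane,
   where area(v,x) = 0; null v are limits of nonnull ones perpendicular to x.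
   The skewness in the last two arguments is metric compatibility together with
   equality of mixed partial derivatives of the metric. *)

(** * Equality of mixed partial derivatives *)

Section MixedDerivatives.
Context {R : realType} {V : normedModType R}.
Implicit Types (f : V -> R) (x y e : V) (h s t : R).

Lemma is_derive_line f y e s : derivable f (y + s *: e) e ->
  is_derive s 1 (fun t => f (y + t *: e)) ('D_e f (y + s *: e)).
Proof.
have E : (fun h => h^-1 *: (f (h *: e + (y + s *: e)) - f (y + s *: e))) =
    (fun h => h^-1 *: (f (y + (h *: 1 + s) *: e) - f (y + s *: e))).
  apply/funext => h; congr (_ *: (f _ - _)).
  by rewrite [h *: 1]mulr1 scalerDl addrCA.
by move=> df; apply: DeriveDef; [move: df; rewrite /derivable E|rewrite /derive E].
Qed.

Lemma MVT_line f y e h : 0 < h ->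
  (forall s, 0 <= s <= h -> derivable f (y + s *: e) e) ->
  exists2 s, 0 <= s <= h & f (y + h *: e) - f y = h * 'D_e f (y + s *: e).
Proof.
move=> h0 df; set g := fun t => f (y + t *: e).
have dg s : 0 <= s <= h -> is_derive s 1 g ('D_e f (y + s *: e)).
  by move=> /df; apply: is_derive_line.
have gc : {within `[0, h], continuous g}.
  apply: derivable_within_continuous => s; rewrite in_itv/= => /dg.
  by case.
have [s|s] := MVT h0 (df := fun s => 'D_e f (y + s *: e)) _ gc.
  by rewrite in_itv/= => /andP[s0 sh]; apply: dg; rewrite !ltW.
rewrite in_itv/= => /andP[s0 sh]; rewrite /g scale0r addr0 subr0 => ->.
by exists s; rewrite ?ltW// mulrC.
Qed.

(** The mean value theorem is used twice: along [e1] for the increment [f (y + h *: e2) - f y], then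
    along [e2] for ['D_e1 f]. *)
Lemma second_difference f x e1 e2 h : 0 < h ->
  (forall s t, 0 <= s <= h -> 0 <= t <= h ->
     derivable f (x + s *: e1 + t *: e2) e1 /\
     derivable ('D_e1 f) (x + s *: e1 + t *: e2) e2) ->
  exists s t, [/\ 0 <= s <= h, 0 <= t <= h &
    f (x + h *: e1 + h *: e2) - f (x + h *: e1) - f (x + h *: e2) + f x =
    h ^+ 2 * 'D_e2 ('D_e1 f) (x + s *: e1 + t *: e2)].
Proof.
move=> h0 df; have hh : 0 <= h <= h by rewrite lexx ltW.
have oh : (0:R) <= 0 <= h by rewrite lexx ltW.
pose g y := f (y + h *: e2) - f y.
have shiftE y : (fun z => f (z + h *: e2)) \o shift y = f \o shift (y + h *: e2).
  by apply/funext => z /=; rewrite addrA.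
have dsh y : derivable f (y + h *: e2) e1 ->
    is_derive y e1 (fun z => f (z + h *: e2)) ('D_e1 f (y + h *: e2)).
  move=> d; apply: DeriveDef; first by move: d; rewrite /derivable shiftE.
  by rewrite /derive shiftE.
have dg s : 0 <= s <= h -> is_derive (x + s *: e1) e1 g
    ('D_e1 f (x + s *: e1 + h *: e2) - 'D_e1 f (x + s *: e1)).
  move=> sh; apply: is_deriveB; first by apply: dsh; case: (df s h sh hh).
  apply: derivableP; have [+ _] := df s 0 sh oh.
  by rewrite scale0r addr0.
have [|s sh Es] := @MVT_line g x e1 h h0 _; first by move=> s /dg[].
have [t th|t th Et] := @MVT_line ('D_e1 f) (x + s *: e1) e2 h h0 _.
  by case: (df s t sh th).
exists s, t; split => //; have [_ dE] := dg _ sh.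
have -> : f (x + h *: e1 + h *: e2) - f (x + h *: e1) - f (x + h *: e2) + f x =
  g (x + h *: e1) - g x by rewrite /g; ring.
by rewrite Es dE Et mulrA.
Qed.

(* Both mixed derivatives, at points close to [x], equal the same second
   difference quotient. *)
Lemma derive_comm f x e1 e2 :
  (\forall y \near x, [/\ derivable f y e1, derivable f y e2,
     derivable ('D_e1 f) y e2 & derivable ('D_e2 f) y e1]) ->
  {for x, continuous ('D_e2 ('D_e1 f))} ->
  {for x, continuous ('D_e1 ('D_e2 f))} ->
  'D_e2 ('D_e1 f) x = 'D_e1 ('D_e2 f) x.
Proof.
move=> df c1 c2; apply/eqP; rewrite -subr_eq0 -normr_le0.
apply/ler_addgt0Pl => eps eps0; rewrite addr0.
have e20 : 0 < eps / 2 by rewrite divr_gt0.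
move/cvgrPdist_lt : c1 => /(_ _ e20) c1.
move/cvgrPdist_lt : c2 => /(_ _ e20) c2.
have I := @filterI V (nbhs x) (nbhs_filter x).
have F := I _ _ df (I _ _ c1 c2).
have [r /= r0 rP] := (nbhs_ballP x _).1 F.
(* The radius is halved and divided by [N] so that every [x + s *: e1 + t *: e2] with [s], [t] in
   [0, h] lies within [h * N = r / 2] of [x]; the summand 1 keeps [N] positive when [e1] and [e2]
   vanish. *)
pose N := 1 + `|e1| + `|e2|.
have N0 : 0 < N by rewrite /N -addrA ltr_wpDr// addr_ge0.
pose h := r / 2 / N.
have h0 : 0 < h by rewrite !divr_gt0.
have inb s t : 0 <= s <= h -> 0 <= t <= h -> ball x r (x + s *: e1 + t *: e2).
  move=> /andP[s0 sh] /andP[t0 th]; rewrite -ball_normE /ball_/= -addrA opprD.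
  rewrite addNKr normrN (le_lt_trans (ler_normD _ _))// !normrZ !ger0_norm//.
  apply: (@le_lt_trans _ _ (h * N)).
    rewrite /N -addrA mulrDr mulr1 mulrDr ler_wpDl ?(ltW h0)//.
    by rewrite lerD// ler_wpM2r.
  by rewrite /h divfK ?gt_eqF// ltr_pdivrMr// mulr_natr mulr2n ltrDl.
have [s t sh th|s [t [sh th E1]]] := @second_difference f x e1 e2 h h0 _.
  by have [[]] := rP _ (inb s t sh th).
have [t' s' th' sh'|t' [s' [th' sh' E2]]] := @second_difference f x e2 e1 h h0 _.
  have [[_ df2 _ df21] _] := rP _ (inb s' t' sh' th').
  by rewrite (addrAC x (t' *: e2)); split; [exact: df2|exact: df21].
have [_ [P1 _]] := rP _ (inb s t sh th).
have [_ [_ P2]] := rP _ (inb s' t' sh' th').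
have E : 'D_e2 ('D_e1 f) (x + s *: e1 + t *: e2) =
         'D_e1 ('D_e2 f) (x + s' *: e1 + t' *: e2).
  have h2 : h ^+ 2 != 0 by rewrite expf_neq0 ?gt_eqF.
  rewrite (addrAC x (s' *: e1) (t' *: e2)).
  apply: (mulfI h2).
  rewrite -[LHS]E1 -[RHS]E2.
  by rewrite (addrAC x (h *: e2)) (addrAC (f _)).
set A := 'D_e2 ('D_e1 f) x in P1 *; set B := 'D_e1 ('D_e2 f) x in P2 *.
rewrite -E in P2; move: P1 P2; set C := 'D_e2 _ (_ + _) => P1 P2.
rewrite (_ : A - B = (A - C) - (B - C)); last by ring.
apply: le_trans (ler_normB _ _) _.
rewrite (splitr eps).
apply: lerD.
  exact: ltW P1.
exact: ltW P2.
Qed.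

End MixedDerivatives.

(** * Skew-symmetry of the curvature tensor *)

Section ChristoffelAlgebra.
Context {R : realType} {n : nat}.
(** Values at one point, treated as independent arrays: the metric, its first and second partials
    (differentiation indices first), the Christoffel symbols with upper index first, and their
    partials. [lower] is Koszul's formula and [dlower] its derivative. *)
Variables (G : 'I_n -> 'I_n -> R) (dG : 'I_n -> 'I_n -> 'I_n -> R)
  (ddG : 'I_n -> 'I_n -> 'I_n -> 'I_n -> R)
  (Ch : 'I_n -> 'I_n -> 'I_n -> R) (dCh : 'I_n -> 'I_n -> 'I_n -> 'I_n -> R).
Hypotheses (G_sym : forall i j, G i j = G j i)
  (dG_sym : forall a i j, dG a i j = dG a j i)
  (ddG_sym : forall a b i j, ddG a b i j = ddG a b j i)
  (ddG_comm : forall a b i j, ddG a b i j = ddG b a i j).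
Hypothesis lower : forall m i j,
  \sum_l G m l * Ch l i j = 2^-1 * (dG i j m + dG j i m - dG m i j).
Hypothesis dlower : forall a m i j,
  \sum_l (dG a m l * Ch l i j + G m l * dCh a l i j) =
  2^-1 * (ddG a i j m + ddG a j i m - ddG a m i j).

(** [L] is the Christoffel symbol of the first kind, [P i m j k] is the inner product of nabla_i d_m
    and nabla_j d_k, and [DL a m i j] is the derivative of [L m i j] along d_a. *)
Let L m i j := \sum_l G m l * Ch l i j.
Let P i m j k := \sum_l L l i m * Ch l j k.
Let DL a m i j := 2^-1 * (ddG a i j m + ddG a j i m - ddG a m i j).

Lemma metric_compatible i j k : dG i j k = L j i k + L k i j.
Proof.
by rewrite /L !lower (dG_sym i k j) (dG_sym k i j) (dG_sym j i k); lra.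
Qed.

Lemma quadratic_term_sym (i m j k : 'I_n) : P i m j k = P j k i m.
Proof.
rewrite /P /L.
under eq_bigr do rewrite mulr_suml.
under [RHS]eq_bigr do rewrite mulr_suml.
rewrite exchange_big /=; apply: eq_bigr => a _; apply: eq_bigr => b _.
rewrite (G_sym b a); ring.
Qed.

(* Lowering the index inside the derivative trades [dCh] for derivatives of the
   metric; metric compatibility then cancels half of the quadratic terms. *)
Lemma lowered_half a m j k :
  \sum_l (dCh a l j k + \sum_r Ch l a r * Ch r j k) * G l m =
  DL a m j k - P a m j k.
Proof.
have E1 : \sum_l G m l * dCh a l j k =
    DL a m j k - \sum_l (L m a l + L l a m) * Ch l j k.
  have E0 : \sum_l dG a m l * Ch l j k = \sum_l (L m a l + L l a m) * Ch l j k.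
    by apply: eq_bigr => l _; rewrite (metric_compatible a m l) addrC.
  by rewrite /DL -dlower big_split /= E0 addrAC subrr add0r.
have E2 : \sum_l (\sum_r Ch l a r * Ch r j k) * G l m =
    \sum_r L m a r * Ch r j k.
  rewrite /L; under eq_bigr do rewrite mulr_suml.
  under [RHS]eq_bigr do rewrite mulr_suml.
  rewrite exchange_big /=; apply: eq_bigr => r _; apply: eq_bigr => l _.
  rewrite (G_sym l m); ring.
under eq_bigr do rewrite mulrDl.
rewrite big_split /= E2.
under eq_bigr do rewrite mulrC (G_sym _ m).
rewrite E1; under eq_bigr do rewrite mulrDl.
rewrite big_split /= /P; ring.
Qed.

Let RL i j k m := \sum_l (dCh i l j k - dCh j l i k +
  \sum_r (Ch l i r * Ch r j k - Ch l j r * Ch r i k)) * G l m.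

(** On symmetrising in [k] and [m], the second-order terms collapse to [ddG i j k m - ddG j i k m],
    zero by equality of mixed partials, and the quadratic terms cancel in pairs by the symmetry of
    [P]. *)
Lemma lowered_riemann_antisym i j k m : RL i j k m + RL i j m k = 0.
Proof.
have E p q : RL i j p q = DL i q j p - P i q j p - (DL j q i p - P j q i p).
  rewrite -!lowered_half -sumrB; apply: eq_bigr => l _.
  by rewrite sumrB -mulrBl; congr (_ * _); ring.
rewrite !E (quadratic_term_sym i m) (quadratic_term_sym j m) /DL.
rewrite !(ddG_comm j) (ddG_sym i j m k); ring.
Qed.
End ChristoffelAlgebra.

(** * Derivability of sums, products, determinants and matrix inverses *)

Section Derivability.
Context {R : realType} {V : normedModType R}.
Implicit Types (x v : V).

Lemma derivable_mulfun (f h : V -> R) x v : derivable f x v -> derivable h x v ->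
  derivable (fun y => f y * h y) x v.
Proof. exact: derivableM. Qed.

Lemma derivable_scalefun (c : R) (f : V -> R) x v : derivable f x v ->
  derivable (fun y => c * f y) x v.
Proof. by move=> df; exact: derivableM (derivable_cst c x v) df. Qed.

Lemma derivable_sumfun (I : Type) (r : seq I) (P : pred I) (F : I -> V -> R) x v :
  (forall i, derivable (F i) x v) ->
  derivable (fun y => \sum_(i <- r | P i) F i y) x v.
Proof.
move=> dF; elim: r => [|i r IH].
  by under eq_fun do rewrite big_nil; exact: derivable_cst.
under eq_fun do rewrite big_cons; case: (P i); last exact: IH.
exact: derivableD (dF i) IH.
Qed.

Lemma derivable_prodfun (I : Type) (r : seq I) (P : pred I) (F : I -> V -> R) x v :
  (forall i, derivable (F i) x v) ->
  derivable (fun y => \prod_(i <- r | P i) F i y) x v.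
Proof.
move=> dF; elim: r => [|i r IH].
  by under eq_fun do rewrite big_nil; exact: derivable_cst.
under eq_fun do rewrite big_cons; case: (P i); last exact: IH.
exact: derivableM (dF i) IH.
Qed.

Lemma derivable_det n (A : V -> 'M[R]_n) x v :
  (forall i j, derivable (fun y => A y i j) x v) ->
  derivable (fun y => \det (A y)) x v.
Proof.
move=> dA; apply: derivable_sumfun => s.
by apply: derivable_scalefun; exact: derivable_prodfun.
Qed.

(** Cramer's rule: near [x] the entry is a cofactor divided by a determinant that does not
    vanish. *)
Lemma derivable_invmx n (A : V -> 'M[R]_n) x v i j :
  (forall k l, derivable (fun y => A y k l) x v) ->
  (\forall y \near x, A y \in unitmx) ->
  derivable (fun y => invmx (A y) i j) x v.
Proof.
move=> dA uA.
apply: (@near_eq_derivable _ _ _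
  (fun y => (\det (A y))^-1 * ((-1) ^+ (j + i) * \det (row' j (col' i (A y)))))).
  by near=> y; rewrite /invmx (_ : A y \in unitmx) ?mxE ?mxE//; near: y.
apply: (@derivable_mulfun (fun y => (\det (A y))^-1)).
  apply: derivableV; last exact: derivable_det.
  by have := nbhs_singleton uA; rewrite unitmxE unitfE.
apply: derivable_scalefun.
apply: derivable_det => k l; rewrite (_ : (fun _ => _) =
  (fun y => A y (lift j k) (lift i l))) //.
by apply/funext => y; rewrite !mxE.
Unshelve. all: by end_near. Qed.

Lemma derive_sumfun (I : Type) (r : seq I) (F : I -> V -> R) x v :
  (forall i, derivable (F i) x v) ->
  'D_v (fun y => \sum_(i <- r) F i y) x = \sum_(i <- r) 'D_v (F i) x.
Proof.
move=> dF; elim: r => [|i r IH].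
  by under eq_fun do rewrite big_nil; rewrite big_nil derive_cst.
under eq_fun do rewrite big_cons; rewrite big_cons -IH.
by rewrite -deriveD//; exact: derivable_sumfun.
Qed.

End Derivability.

(** * The curvature tensor of a smooth metric in coordinates *)

Section SmoothMetric.
Context {R : realType} {n : nat}.
Variables (U : set 'rV[R]_n) (g : 'rV[R]_n -> 'M[R]_n).
Hypotheses (U_open : open U) (g_smooth : smooth_on U g).
Implicit Types (x y : 'rV[R]_n) (i j k l m : 'I_n).

Lemma near_open x : U x -> \forall y \near x, U y.
Proof. by move=> Ux; apply: open_nbhs_nbhs. Qed.

(** Differentiability is known only on [U], so the two functions agree only there; openness of [U]
    makes them agree near [y], which is enough for the next derivative. *)
Lemma partial_entry s k l y : U y ->
  foldr partial (fun z => g z k l) s y = foldr partial g s y k l.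
Proof.
elim: s y => //= i s IH y Uy; rewrite /partial.
rewrite (@near_eq_derive _ _ _ _ (fun z => foldr partial g s z k l)); last first.
  by apply: filterS (near_open Uy) => z; apply: IH.
by rewrite derive_mx ?mxE//; apply: diff_derivable; apply: g_smooth.
Qed.

Lemma derivable_partial_entry s i k l x : U x ->
  derivable (foldr partial (fun z => g z k l) s) x (delta_mx 0 i).
Proof.
move=> Ux; apply: (@near_eq_derivable _ _ _ (fun z => foldr partial g s z k l)).
  by apply: filterS (near_open Ux) => z Uz; rewrite partial_entry.
have /derivable_mxP : derivable (foldr partial g s) x (delta_mx 0 i).
  exact/diff_derivable/g_smooth.
exact.
Qed.

Lemma continuous_partial_entry s k l x : U x ->
  {for x, continuous (foldr partial (fun z => g z k l) s)}.
Proof.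
move=> Ux; rewrite /prop_for /continuous_at partial_entry//.
apply: (@cvg_trans _ (foldr partial g s z k l @[z --> x])).
  have E : {near x, (fun z => foldr partial g s z k l) =1
      foldr partial (fun z => g z k l) s}.
    by apply: filterS (near_open Ux) => z Uz; rewrite partial_entry.
  exact: near_eq_cvg E.
have /differentiable_continuous c := g_smooth s Ux.
exact: (continuous_comp c (@coord_continuous R _ _ k l _)).
Qed.

Lemma partial_comm i j k l x : U x ->
  partial i (partial j (fun z => g z k l)) x =
  partial j (partial i (fun z => g z k l)) x.
Proof.
move=> Ux; apply: derive_comm.
- apply: filterS (near_open Ux) => y Uy; split.
  + exact: (@derivable_partial_entry [::]).
  + exact: (@derivable_partial_entry [::]).
  + exact: (@derivable_partial_entry [:: j]).
  + exact: (@derivable_partial_entry [:: i]).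
- exact: (@continuous_partial_entry [:: i; j]).
- exact: (@continuous_partial_entry [:: j; i]).
Qed.

Hypotheses (g_sym : forall y, U y -> (g y)^T = g y)
  (g_unit : forall y, U y -> g y \in unitmx).

(** Contraction with [g] cancels the [invmx] in the definition and leaves Koszul's formula. *)
Lemma christoffel_lower m i j y : U y ->
  \sum_l g y m l * christoffel g l i j y =
  2^-1 * (partial i (fun z => g z j m) y + partial j (fun z => g z i m) y -
          partial m (fun z => g z i j) y).
Proof.
move=> Uy; rewrite /christoffel.
under eq_bigr do rewrite mulrCA.
rewrite -mulr_sumr; congr (_ * _).
under eq_bigr do rewrite mulr_sumr.
rewrite exchange_big /=.
under eq_bigr do (under eq_bigr do rewrite mulrA; rewrite -mulr_suml).
have E p : \sum_l g y m l * invmx (g y) l p = (m == p)%:R.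
  by have /matrixP/(_ m p) := mulmxV (g_unit Uy); rewrite !mxE.
under eq_bigr do rewrite E.
rewrite (bigD1 m)//= eqxx mul1r big1 ?addr0// => p /negbTE pm.
by rewrite eq_sym pm mul0r.
Qed.

Lemma derivable_christoffel l i j a x : U x ->
  derivable (christoffel g l i j) x (delta_mx 0 a).
Proof.
move=> Ux; apply: derivable_scalefun.
apply: derivable_sumfun => p.
apply: (@derivable_mulfun _ _ (fun y => invmx (g y) l p)).
  apply: derivable_invmx => [k q|]; first exact: (@derivable_partial_entry [::]).
  by apply: filterS (near_open Ux) => y; exact: g_unit.
apply: derivableB; last exact: (@derivable_partial_entry [:: p]).
by apply: derivableD; [exact: (@derivable_partial_entry [:: i])|
  exact: (@derivable_partial_entry [:: j])].
Qed.

(** Koszul's formula holds on a neighbourhood of [x], so both of its sides may be differentiated. *)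
Lemma partial_christoffel_lower a m i j x : U x ->
  \sum_l (partial a (fun z => g z m l) x * christoffel g l i j x +
          g x m l * partial a (christoffel g l i j) x) =
  2^-1 * (partial a (partial i (fun z => g z j m)) x +
          partial a (partial j (fun z => g z i m)) x -
          partial a (partial m (fun z => g z i j)) x).
Proof.
move=> Ux.
have dg p q : derivable (fun z => g z p q) x (delta_mx 0 a).
  exact: (@derivable_partial_entry [::]).
have ddg b p q : derivable (partial b (fun z => g z p q)) x (delta_mx 0 a).
  exact: (@derivable_partial_entry [:: b]).
have dC l : derivable (christoffel g l i j) x (delta_mx 0 a).
  exact: derivable_christoffel.
transitivity (partial a (fun y => \sum_l g y m l * christoffel g l i j y) x).
  rewrite /partial derive_sumfun => [|l]; last exact: derivable_mulfun.
  apply: eq_bigr => l _; rewrite [RHS](deriveM (dg m l) (dC l)).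
  by rewrite addrC; congr (_ + _); rewrite mulrC.
transitivity (partial a (fun y => 2^-1 * ((partial i (fun z => g z j m) +
    partial j (fun z => g z i m) - partial m (fun z => g z i j)) y)) x).
  apply: near_eq_derive; apply: filterS (near_open Ux) => y Uy.
  exact: christoffel_lower.
have dd : derivable (partial i (fun z => g z j m) +
    partial j (fun z => g z i m)) x (delta_mx 0 a) by exact: derivableD.
rewrite [LHS](deriveMl _ (derivableB dd (ddg m i j))); congr (_ * _).
rewrite [LHS](deriveB dd (ddg m i j)); congr (_ - _).
exact: deriveD (ddg i j m) (ddg j i m).
Qed.

Let lowered i j k m x := \sum_l riemann g l i j k x * g x l m.

(** Multilinearity and both skew symmetries are read off from this expansion. Index [k] goes with
    [d] and [m] with [c], since [curvature] pairs R(a,b)d with [c]. *)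
Lemma curvatureE x a b c d : curvature g x a b c d =
  \sum_i \sum_j \sum_k \sum_m
    a 0 i * b 0 j * d 0 k * c 0 m * lowered i j k m x.
Proof.
have E m : (riemann_op g x a b d *m g x) 0 m =
    \sum_i \sum_j \sum_k a 0 i * b 0 j * d 0 k * lowered i j k m x.
  rewrite !mxE; under eq_bigr => l _.
    rewrite !mxE mulr_suml; under eq_bigr => i _.
      rewrite mulr_suml; under eq_bigr do rewrite mulr_suml.
      over.
    over.
  rewrite exchange_big; apply: eq_bigr => i _ /=.
  rewrite exchange_big; apply: eq_bigr => j _ /=.
  rewrite exchange_big; apply: eq_bigr => k _ /=.
  by rewrite mulr_sumr; apply: eq_bigr => l _; rewrite mulrA.
rewrite /curvature /inner mxE; under eq_bigr => m _.
  rewrite E mulr_suml; under eq_bigr => i _.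
    rewrite mulr_suml; under eq_bigr do rewrite mulr_suml.
    over.
  over.
rewrite exchange_big; apply: eq_bigr => i _ /=.
rewrite exchange_big; apply: eq_bigr => j _ /=.
rewrite exchange_big; apply: eq_bigr => k _ /=.
by apply: eq_bigr => m _; rewrite mxE mulrAC.
Qed.

Lemma eq_opp0 (r : R) : r = - r -> r = 0.
Proof. by move=> E; lra. Qed.

Lemma curvature_antisym12 x b c d : curvature g x b b c d = 0.
Proof.
(* Exchanging the two summation indices attached to [b] turns the sum into its own negative. *)
apply: eq_opp0; rewrite curvatureE {1}exchange_big /= -sumrN.
apply: eq_bigr => i _; rewrite -sumrN; apply: eq_bigr => j _.
rewrite -sumrN; apply: eq_bigr => k _; rewrite -sumrN; apply: eq_bigr => m _.
have -> : lowered j i k m x = - lowered i j k m x.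
  rewrite -sumrN; apply: eq_bigr => l _; rewrite -mulNr; congr (_ * _).
  rewrite /riemann !opprD opprK (addrC (- _)) -sumrN; congr (_ + _).
  by apply: eq_bigr => p _; rewrite opprB.
ring.
Qed.

Lemma curvature_antisym34 x a b c : U x -> curvature g x a b c c = 0.
Proof.
move=> Ux; apply: eq_opp0; rewrite curvatureE -sumrN.
apply: eq_bigr => i _; rewrite -sumrN; apply: eq_bigr => j _.
(* Same device on the last pair of indices, where the sign change of the components is
   [lowered_riemann_antisym]. *)
rewrite {1}exchange_big /= -sumrN; apply: eq_bigr => k _.
rewrite -sumrN; apply: eq_bigr => m _.
have gsym p q y : U y -> g y p q = g y q p.
  by move=> /g_sym /matrixP/(_ q p); rewrite mxE.
have partial_sym p q v y : U y ->
    partial v (fun z => g z p q) y = partial v (fun z => g z q p) y.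
  move=> Uy; apply: near_eq_derive; apply: filterS (near_open Uy) => z.
  exact: gsym.
have := @lowered_riemann_antisym R n (fun p q => g x p q)
  (fun v p q => partial v (fun z => g z p q) x)
  (fun v w p q => partial v (partial w (fun z => g z p q)) x)
  (fun l p q => christoffel g l p q x)
  (fun v l p q => partial v (christoffel g l p q) x).
move=> /(_ _ _ _ _ _ _ i j k m) H.
have : lowered i j k m x + lowered i j m k x = 0.
  apply: H => [p q|v p q|v w p q|v w p q|p q r|v p q r].
  - exact: gsym.
  - exact: partial_sym.
  - apply: near_eq_derive; apply: filterS (near_open Ux) => z.
    exact: partial_sym.
  - exact: partial_comm.
  - exact: christoffel_lower.
  - exact: partial_christoffel_lower.
move/eqP; rewrite addrC addr_eq0 => /eqP ->; ring.
Qed.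
End SmoothMetric.

(** * Curvature on Lorentz 3-spaces *)

Section SLemma.
Context {R : realType} {W : lmodType R}.
Variables (q A : W -> R) (bq bA : W -> W -> R).
Hypotheses (qE : forall a b t, q (a + t *: b) = q a + t * bq a b + t ^+ 2 * q b)
  (AE : forall a b t, A (a + t *: b) = A a + t * bA a b + t ^+ 2 * A b).

(** As [A] has opposite signs at [a] and [b], the quadratic [A (a + t *: b)] in [t] has roots
    [t1 < 0 < t2] with [t1 * t2 = A a / A b]. The hypothesis gives [q] nonnegative at both, and a
    positive combination of these two facts is the claim. *)
Lemma S_lemma_ratio a b : (forall w, A w = 0 -> 0 <= q w) ->
  0 < A a -> A b < 0 -> q b / A b <= q a / A a.
Proof.
move=> q0 Aa Ab.
pose D := Num.sqrt (bA a b ^+ 2 - 4 * A b * A a).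
have D2 : D ^+ 2 = bA a b ^+ 2 - 4 * A b * A a.
  by rewrite sqr_sqrtr//; have := sqr_ge0 (bA a b); nra.
have D0 : 0 < D.
  by rewrite sqrtr_gt0; have := sqr_ge0 (bA a b); nra.
have Ab0 : A b != 0 by rewrite lt_eqF.
pose t1 := (- bA a b + D) / (2 * A b).
pose t2 := (- bA a b - D) / (2 * A b).
have root1 : A a + t1 * bA a b + t1 ^+ 2 * A b = 0.
  have -> : A a + t1 * bA a b + t1 ^+ 2 * A b =
    (D ^+ 2 - (bA a b ^+ 2 - 4 * A b * A a)) / (4 * A b) by rewrite /t1; field.
  by rewrite D2 subrr mul0r.
have root2 : A a + t2 * bA a b + t2 ^+ 2 * A b = 0.
  have -> : A a + t2 * bA a b + t2 ^+ 2 * A b =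
    (D ^+ 2 - (bA a b ^+ 2 - 4 * A b * A a)) / (4 * A b) by rewrite /t2; field.
  by rewrite D2 subrr mul0r.
have prod : t1 * t2 * A b = A a.
  have -> : t1 * t2 * A b = (bA a b ^+ 2 - D ^+ 2) / (4 * A b).
    by rewrite /t1 /t2; field.
  by rewrite D2; field.
have dif : t1 - t2 = D / A b by rewrite /t1 /t2; field.
have t12 : t1 < t2.
  by rewrite -subr_lt0 dif pmulr_rlt0// invr_lt0.
have t12' : t1 * t2 < 0 by nra.
have t1_lt0 : t1 < 0 by nra.
have t2_gt0 : 0 < t2 by nra.
have q1 : 0 <= q a + t1 * bq a b + t1 ^+ 2 * q b.
  by rewrite -qE; apply: q0; rewrite AE.
have q2 : 0 <= q a + t2 * bq a b + t2 ^+ 2 * q b.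
  by rewrite -qE; apply: q0; rewrite AE.
(* The weights t2 and - t1 cancel the cross terms of the two null vectors. *)
have key : 0 <= (t2 - t1) * (q a - t1 * t2 * q b).
  have -> : (t2 - t1) * (q a - t1 * t2 * q b) =
    t2 * (q a + t1 * bq a b + t1 ^+ 2 * q b) -
    t1 * (q a + t2 * bq a b + t2 ^+ 2 * q b) by ring.
  by rewrite -mulNr addr_ge0// mulr_ge0// ?oppr_ge0 ltW.
rewrite pmulr_rge0 ?subr_gt0// in key.
rewrite ler_pdivlMr// -subr_ge0.
by have -> : q a - q b / A b * A a = q a - t1 * t2 * q b by rewrite -prod; field.
Qed.

(** By the ratio inequality, every [q / A] where [A] is negative lies below every [q / A] where [A]
    is positive; the supremum of the former separates the two sets and serves as [K]. *)
Lemma S_lemma : (exists a, 0 < A a) -> (exists b, A b < 0) ->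
  (forall w, A w = 0 -> 0 <= q w) -> exists K, forall w, K * A w <= q w.
Proof.
move=> [a Aa] [b Ab] q0.
pose S := [set r | exists2 c, A c < 0 & r = q c / A c].
have supS c : 0 < A c -> ubound S (q c / A c).
  by move=> Ac _ [d Ad ->]; apply: S_lemma_ratio.
exists (sup S) => w; have [Aw|Aw|Aw] := ltgtP (A w) 0.
- rewrite -ler_ndivrMr//; apply: ub_le_sup; last by exists w.
  by exists (q a / A a); apply: supS.
- rewrite -ler_pdivlMr//; apply: ge_sup; last exact: supS.
  by exists (q b / A b), b.
- by rewrite Aw mulr0; exact: q0.
Qed.

End SLemma.

(** A limit argument as [t] tends to 0. The side condition is shaped for a null vector perturbed by
    [t *: u]: its square is then [t * (al + t * be)]. *)
Lemma quadratic_ge0 (R : realType) (a b c al be : R) : al != 0 ->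
  (forall t, t * (al + t * be) != 0 -> 0 <= a + t * (b + t * c)) -> 0 <= a.
Proof.
move=> al0 H; rewrite leNgt; apply/negP => a0.
have al0' : 0 < `|al| by rewrite normr_gt0.
pose N := 1 + `|b| + `|c| + `|be|.
have [b0 c0 be0] : [/\ 0 <= `|b|, 0 <= `|c| & 0 <= `|be|] by [].
have N1 : 1 <= N by rewrite /N; lra.
(* If [a] were negative, this [r] would yield a [t] so small that [t * be] cannot cancel [al] and
   the terms in [b] and [c] cannot outweigh [a]. *)
pose r := Num.min 1 (Num.min (- a) `|al|).
have r0 : 0 < r by rewrite !lt_min ltr01 oppr_gt0 a0.
have [r1 ra ral] : [/\ r <= 1, r <= - a & r <= `|al|].
  by rewrite /r !ge_min !lexx !orbT; split.
pose t := r / (2 * N).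
have t0 : 0 < t by rewrite divr_gt0//; lra.
have tN : t * N = r / 2 by rewrite /t; field; apply/eqP; lra.
have t1 : t <= 1 by nra.
have /H : t * (al + t * be) != 0.
  apply: mulf_neq0; first by rewrite gt_eqF.
  rewrite addr_eq0; apply/eqP => alE.
  have : `|al| = t * `|be| by rewrite alE normrN normrM gtr0_norm.
  have : t * `|be| <= t * N by rewrite ler_pM2l// /N; lra.
  by lra.
have : t * b <= t * `|b| by rewrite ler_pM2l// ler_norm.
have : t * (t * c) <= t * `|c|.
  rewrite ler_pM2l//; apply: le_trans (_ : t * `|c| <= _).
    by rewrite ler_pM2l// ler_norm.
  by rewrite ler_piMl.
have : t * (`|b| + `|c|) <= t * N by rewrite ler_pM2l// /N; lra.
lra.
Qed.

(** * Null condition and 3-space bounds for one algebraic curvature tensor *)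

Section CurvatureLike.
Context {R : realType} {E : lmodType R}.
Implicit Types (v w x y e : E) (s t : R).

Record curvature_like (T : E -> E -> E -> E -> R) : Prop := {
  curv_lin1 : forall b c d, scalar (fun a => T a b c d) ;
  curv_lin2 : forall a c d, scalar (fun b => T a b c d) ;
  curv_lin3 : forall a b d, scalar (fun c => T a b c d) ;
  curv_lin4 : forall a b c, scalar (fun d => T a b c d) ;
  curv_alt12 : forall a c d, T a a c d = 0 ;
  curv_alt34 : forall a b c, T a b c c = 0 }.

(** Reduces the statements with reversed inequalities to the direct ones. *)
Lemma curvature_likeN T : curvature_like T ->
  curvature_like (fun a b c d => - T a b c d).
Proof.
move=> [l1 l2 l3 l4 a1 a2]; split => [b c d t a a'|a c d t b b'|a b d t c c'|
  a b c t d d'|a c d|a b c].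
- by rewrite l1 opprD mulrN.
- by rewrite l2 opprD mulrN.
- by rewrite l3 opprD mulrN.
- by rewrite l4 opprD mulrN.
- by rewrite a1 oppr0.
- by rewrite a2 oppr0.
Qed.

Record inner_like (I : E -> E -> R) : Prop := {
  inner_lin : forall w, scalar (fun v => I v w) ;
  inner_sym : forall v w, I v w = I w v }.

Definition null_ge0 (I : E -> E -> R) (T : E -> E -> E -> E -> R) :=
  forall x v, x != 0 -> I x x = 0 -> v != 0 -> I v x = 0 -> 0 <= T v x v x.

(* With s = -1 this covers signature (+,-,-), where the area form is the same. *)
Definition lorentz_frame (I : E -> E -> R) s e1 e2 e3 : Prop :=
  [/\ I e1 e1 = s, I e2 e2 = s & I e3 e3 = - s] /\
  [/\ I e1 e2 = 0, I e1 e3 = 0 & I e2 e3 = 0].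

Definition comb e1 e2 e3 (a1 a2 a3 : R) := a1 *: e1 + (a2 *: e2 + a3 *: e3).

Definition in_span e1 e2 e3 v := exists a1 a2 a3, v = comb e1 e2 e3 a1 a2 a3.

Lemma scalar_comb (f : E -> R) e1 e2 e3 a1 a2 a3 : scalar f ->
  f (comb e1 e2 e3 a1 a2 a3) = a1 * f e1 + a2 * f e2 + a3 * f e3.
Proof.
move=> lf; have f0 : f 0 = 0 by have := lf 1 0 0; rewrite scaler0 addr0; lra.
by rewrite /comb !lf -[a3 *: e3]addr0 lf f0; ring.
Qed.

(** The form factors through the bivector of its arguments, whose coordinates in e2/\e3, e3/\e1,
    e1/\e2 form the cross product of the coefficient triples. *)
Lemma alternating_comb (f : E -> E -> R) e1 e2 e3 a1 a2 a3 b1 b2 b3 :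
  (forall w, scalar (fun v => f v w)) -> (forall v, scalar (f v)) ->
  (forall v, f v v = 0) ->
  f (comb e1 e2 e3 a1 a2 a3) (comb e1 e2 e3 b1 b2 b3) =
  (a2 * b3 - a3 * b2) * f e2 e3 + (a3 * b1 - a1 * b3) * f e3 e1 +
  (a1 * b2 - a2 * b1) * f e1 e2.
Proof.
move=> l1 l2 alt.
have anti v w : f v w = - f w v.
  have := alt (1 *: v + w); rewrite l1 !(l2 _ 1) !alt; lra.
rewrite (scalar_comb _ _ _ _ _ _ (l1 _)) !scalar_comb// !alt.
rewrite (anti e2 e1) (anti e1 e3) (anti e3 e2); ring.
Qed.

Lemma null_ge0_bound I T s e1 e2 e3 : inner_like I -> curvature_like T ->
  s ^+ 2 = 1 -> lorentz_frame I s e1 e2 e3 -> null_ge0 I T ->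
  exists K, forall v w, in_span e1 e2 e3 v -> in_span e1 e2 e3 w ->
    K * (I v v * I w w - I v w ^+ 2) <= T v w v w.
Proof.
move=> [Il Is] [l1 l2 l3 l4 alt12 alt34] s1 [[I11 I22 I33] [I12 I13 I23]] T0.
have Il2 v : scalar (I v).
  by move=> t y z; rewrite ![I v _]Is Il.
have IE a1 a2 a3 b1 b2 b3 : I (comb e1 e2 e3 a1 a2 a3) (comb e1 e2 e3 b1 b2 b3) =
    s * (a1 * b1 + a2 * b2 - a3 * b3).
  rewrite (scalar_comb _ _ _ _ _ _ (Il _)) !scalar_comb//.
  rewrite (Is e2 e1) (Is e3 e1) (Is e3 e2) I11 I22 I33 I12 I13 I23; ring.
(* [q0] is the quadratic form on bivectors with [T v w v w] equal to its value at v/\w; [Q] expands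
   only the last pair of arguments. *)
pose Q v w (n1 n2 n3 : R) := n1 * T v w e2 e3 + n2 * T v w e3 e1 + n3 * T v w e1 e2.
pose q0 n1 n2 n3 := n1 * Q e2 e3 n1 n2 n3 + n2 * Q e3 e1 n1 n2 n3 +
  n3 * Q e1 e2 n1 n2 n3.
have TE a1 a2 a3 b1 b2 b3 :
    let v := comb e1 e2 e3 a1 a2 a3 in let w := comb e1 e2 e3 b1 b2 b3 in
    T v w v w = q0 (a2 * b3 - a3 * b2) (a3 * b1 - a1 * b3) (a1 * b2 - a2 * b1).
  move=> v w; rewrite [LHS](alternating_comb (f := fun a b => T a b v w))//.
  by rewrite /q0 /Q /v /w; congr (_ * _ + _ * _ + _ * _); exact: alternating_comb.
pose q (n : 'rV[R]_3) := q0 (n 0 0) (n 0 1) (n 0 2%:R).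
(* The area form on bivectors: since [s ^+ 2 = 1], the planes containing [e3] have area -1 and
   e1/\e2 has area 1, for either sign [s]. *)
pose A (n : 'rV[R]_3) := - n 0 0 ^+ 2 - n 0 1 ^+ 2 + n 0 2%:R ^+ 2.
pose bA (n m : 'rV[R]_3) :=
  2 * (- n 0 0 * m 0 0 - n 0 1 * m 0 1 + n 0 2%:R * m 0 2%:R).
pose bq (n m : 'rV[R]_3) := q (n + m) - q n - q m.
have AE n m t : A (n + t *: m) = A n + t * bA n m + t ^+ 2 * A m.
  by rewrite /A /bA !mxE; ring.
have qE n m t : q (n + t *: m) = q n + t * bq n m + t ^+ 2 * q m.
  by rewrite /q /bq /q /q0 /Q !mxE; ring.
pose vec (a b c : R) : 'rV[R]_3 := \row_i [:: a; b; c]`_i.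
have [||n A0|K HK] := S_lemma qE AE.
- by exists (vec 0 0 1); rewrite /A !mxE/=; lra.
- by exists (vec 1 0 0); rewrite /A !mxE/=; lra.
- rewrite /q; move: A0; rewrite /A; set n1 := n 0 0; set n2 := n 0 1.
  set n3 := n 0 2%:R => A0.
  (* A null bivector satisfies n1^2 + n2^2 = n3^2, so [n3 = 0] makes it zero. *)
  have [n30|n30] := eqVneq n3 0.
    have n10 : n1 = 0 by apply/eqP; rewrite -sqrf_eq0; apply/eqP; nra.
    have n20 : n2 = 0 by apply/eqP; rewrite -sqrf_eq0; apply/eqP; nra.
    by rewrite n10 n20 n30 /q0 /Q; lra.
  have s0 : s != 0 by apply/eqP => s0; move: s1; rewrite s0; lra.
  have n32 : 0 < n3 ^+ 2 by rewrite lt_def sqr_ge0 sqrf_eq0 n30.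
  have I0 w : I 0 w = 0 by have := Il w 1 0 0; rewrite scaler0 addr0; lra.
  (* For n null, x is a null vector and v /\ x = - n3 n. *)
  pose x := comb e1 e2 e3 n1 n2 (- n3).
  pose v := comb e1 e2 e3 (- n2) n1 0.
  have x0 : x != 0.
    apply/eqP => x0; have : I x (comb e1 e2 e3 0 0 1) = s * n3 by rewrite IE; ring.
    by rewrite x0 I0 => /esym/eqP; rewrite mulf_eq0 (negbTE s0) (negbTE n30).
  have v0 : v != 0.
    apply/eqP => v0; have : I v v = s * n3 ^+ 2.
      by rewrite IE; congr (_ * _); lra.
    by rewrite v0 I0 => /esym/eqP; rewrite mulf_eq0 (negbTE s0) gt_eqF.
  have := T0 x v x0 _ v0 _; rewrite !IE TE => H.
  have {H} : 0 <= n3 ^+ 2 * q0 n1 n2 n3.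
    have -> : n3 ^+ 2 * q0 n1 n2 n3 =
      q0 (- (n1 * n3)) (- (n2 * n3)) (- n3 ^+ 2) by rewrite /q0 /Q; ring.
    have -> : - (n1 * n3) = n1 * - n3 - 0 * n2 by ring.
    have -> : - (n2 * n3) = 0 * n1 - - n2 * - n3 by ring.
    have -> : - n3 ^+ 2 = - n2 * n2 - n1 * n1 by lra.
    by apply: H; [rewrite (_ : _ - _ = 0) ?mulr0//; lra|ring].
  by rewrite pmulr_rge0.
exists K => _ _ [a1 [a2 [a3 ->]]] [b1 [b2 [b3 ->]]]; rewrite TE !IE.
(* The multiplier inequality is evaluated at v/\w; the remaining identity between the two area
   expressions is Lagrange's. *)
have := HK (vec (a2 * b3 - a3 * b2) (a3 * b1 - a1 * b3) (a1 * b2 - a2 * b1)).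
rewrite /q /A !mxE/=; apply: le_trans; rewrite le_eqVlt; apply/orP; left.
by apply/eqP; congr (_ * _); ring: s1.
Qed.

Definition curvature_bound I T s := forall e1 e2 e3, lorentz_frame I s e1 e2 e3 ->
  exists K, forall v w, in_span e1 e2 e3 v -> in_span e1 e2 e3 w ->
    K * (I v v * I w w - I v w ^+ 2) <= T v w v w.

Section Converse.
Variables (I : E -> E -> R) (T : E -> E -> E -> E -> R).
Hypotheses (I_inner : inner_like I) (T_curv : curvature_like T)
  (I_nondeg : forall x, x != 0 -> exists y, I x y != 0)
  (bound1 : curvature_bound I T 1) (boundN1 : curvature_bound I T (-1)).

Lemma null_ge0_nonnull x v : x != 0 -> I x x = 0 -> I v v != 0 -> I v x = 0 ->
  0 <= T v x v x.
Proof.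
have [Il Is] := I_inner; move=> x0 xx vv vx.
have Ir w : scalar (I w) by move=> t y z; rewrite ![I w _]Is Il.
have IZr w t y : I w (t *: y) = t * I w y.
  have f0 : I w 0 = 0 by have := Ir w 1 0 0; rewrite scaler0 addr0; lra.
  by rewrite -[t *: y]addr0 Ir f0 addr0.
have IZl w t y : I (t *: y) w = t * I y w by rewrite Is IZr Is.
(* In v^perp, y is null with I x y = 1; p and m are orthonormal in the plane
   of x and y, and p + m = x. *)
have [y0 xy0] := I_nondeg x0.
(* Removing the [v] component does not change the pairing with [x], as [v] is perpendicular to [x];
   after normalisation, a multiple of [x] is subtracted to make the vector null. *)
pose y1 := (- (I y0 v / I v v)) *: v + y0.
have vy1 : I v y1 = 0 by rewrite /y1 Ir (Is v y0); field.
have xy1 : I x y1 = I x y0 by rewrite /y1 Ir (Is x v) vx mulr0 add0r.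
pose y2 := (I x y1)^-1 *: y1.
have xy2 : I x y2 = 1 by rewrite IZr mulVf ?xy1.
have vy2 : I v y2 = 0 by rewrite IZr vy1 mulr0.
pose y := (- (I y2 y2 / 2)) *: x + y2.
have xy : I x y = 1 by rewrite Ir xx mulr0 add0r.
have vy : I v y = 0 by rewrite Ir vx mulr0 add0r.
have yy : I y y = 0.
  by rewrite {1}/y Il xy /y Ir [I y2 x]Is xy2; lra.
pose p := 2^-1 *: x + y; pose m := 2^-1 *: x + (-1) *: y.
have II w t r u : I w (t *: r + u) = t * I w r + I w u by exact: Ir.
have xp : I x p = 1 by rewrite II xx xy; lra.
have xm : I x m = -1 by rewrite II IZr xx xy; lra.
have yp : I y p = 2^-1 by rewrite II yy [I y x]Is xy; lra.
have ym : I y m = 2^-1 by rewrite II IZr yy [I y x]Is xy; lra.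
have vp : I v p = 0 by rewrite II vx vy; lra.
have vm : I v m = 0 by rewrite II IZr vx vy; lra.
have pp : I p p = 1 by rewrite {1}/p Il xp yp; lra.
have mm : I m m = -1 by rewrite {1}/m Il IZl xm ym; lra.
have pm : I p m = 0 by rewrite {1}/p Il xm ym; lra.
have xE : x = p + m by rewrite /p /m scaleN1r addrACA subrr addr0 -scalerDl
  -[2^-1]div1r -splitr scale1r.
pose c := Num.sqrt `|I v v|; have c0 : 0 < c by rewrite sqrtr_gt0 normr_gt0.
have c2 : c ^+ 2 = `|I v v| by rewrite sqr_sqrtr.
have cn : c != 0 by rewrite gt_eqF.
pose e := c^-1 *: v.
have vE : v = c *: e by rewrite scalerA mulfV// scale1r.
have ep : I e p = 0 by rewrite IZl vp mulr0.
have em : I e m = 0 by rewrite IZl vm mulr0.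
have ee : I e e = I v v / `|I v v| by rewrite IZl IZr -c2; field.
(* The area of [v] and [x] is zero, so the bound at this pair reads [0 <= T v x v x] whatever [K]
   is. *)
have conclude K e2 e3 : (forall v w, in_span e e2 e3 v -> in_span e e2 e3 w ->
    K * (I v v * I w w - I v w ^+ 2) <= T v w v w) ->
    e2 + e3 = x -> 0 <= T v x v x.
  move=> HK ex; have := HK v x; rewrite xx vx expr0n/= subr0 !mulr0; apply.
    by exists c, 0, 0; rewrite /comb !scale0r !addr0.
  by exists 0, 1, 1; rewrite /comb scale0r !scale1r add0r ex.
(* The sign of [I v v] is that of [e]: a positive [e] joins [p] in a Lorentz frame, a negative one
   joins [m] in an anti-Lorentz frame. *)
have [v0|v0] : 0 < I v v \/ I v v < 0 by apply/orP; rewrite orbC -neq_lt.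
- have [|K HK] := @bound1 e p m; last exact: conclude HK (esym xE).
  by split; split => //; rewrite ee gtr0_norm ?divff.
- have [|K HK] := @boundN1 e m p; last first.
    by apply: conclude HK _; rewrite addrC -xE.
  split; split => //; rewrite ?opprK ?[I m p]Is//.
  by rewrite ee ltr0_norm// invrN mulrN divff.
Qed.

Lemma curvature_bound_null_ge0 : null_ge0 I T.
Proof.
have [Il Is] := I_inner; move=> x v x0 xx v0 vx.
have Ir w : scalar (I w) by move=> t y z; rewrite ![I w _]Is Il.
have [vv|] := eqVneq (I v v) 0; last by move=> vv; apply: null_ge0_nonnull.
have [l1 l2 l3 l4 alt12 _] := T_curv.
have [y0 xy0] := I_nondeg x0.
have f0 w : I w 0 = 0 by have := Ir w 1 0 0; rewrite scaler0 addr0; lra.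
pose y := (I x y0)^-1 *: y0.
have xy : I x y = 1 by rewrite /y -[_ *: _]addr0 Ir f0 addr0 mulVf.
(* As [I x y = 1], a [v] proportional to [x] must be [I v y *: x], and then [T v x v x] vanishes
   because [T] is alternating. *)
have [vE|z0] := eqVneq ((- I v y) *: x + v) 0.
  have {}vE : v = I v y *: x + 0.
    by rewrite addr0; apply/eqP; rewrite -subr_eq0 addrC -scaleNr vE.
  have T0 : T 0 x v x = 0 by have := l1 x v x 1 0 0; rewrite scaler0 addr0; lra.
  by rewrite [X in T X x]vE l1 alt12 T0 mulr0 addr0.
(* The vector paired with [z] is chosen so that its pairing equals [I v u] for the [u] below. *)
have [z zE] := I_nondeg z0.
(* t u + v is perpendicular to x, and nonnull for small t != 0. *)
pose u := (- I z x) *: y + z.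
have ux : I u x = 0 by rewrite /u Il [I y x]Is xy; lra.
have vu : I v u != 0.
  move: zE; rewrite /u Ir Il [I x z]Is; congr (_ != _); ring.
clearbody u.
(* The coefficients are those of [T] at [t *: u + v] and of the square of that vector, which is
   [t * (2 * I v u + t * I u u)] because [v] is null. *)
apply: (@quadratic_ge0 _ _ (T u x v x + T v x u x) (T u x u x) (2 * I v u) (I u u)).
  by rewrite mulf_neq0// pnatr_eq0.
move=> t nz.
have -> : T v x v x + t * (T u x v x + T v x u x + t * T u x u x) =
    T (t *: u + v) x (t *: u + v) x by rewrite l1 !l3; ring.
apply: null_ge0_nonnull => //; last by rewrite Il ux vx mulr0 addr0.
move: nz; rewrite Il !Ir vv [I u v]Is; congr (_ != _); ring.
Qed.

End Converse.
End CurvatureLike.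

(** * Signatures, orthonormal bases and Lorentz frames *)

Section Frames.
Context {R : realType} {n : nat}.
Implicit Types (G : 'M[R]_n) (v w e : 'rV[R]_n) (V : {vspace 'rV[R]_n}).

Lemma inner_scalar G w : scalar (fun v => inner G v w).
Proof. by move=> t v v'; rewrite /inner !mulmxDl -!scalemxAl !mxE. Qed.

Lemma inner_inner_like G : G^T = G -> inner_like (inner G).
Proof.
move=> Gs; split=> [w|v w]; first exact: inner_scalar.
rewrite /inner (_ : v *m G *m w^T = (w *m G *m v^T)^T) ?mxE//.
by rewrite !trmx_mul trmxK Gs mulmxA.
Qed.

Lemma inner_comb G (I : finType) (k : I -> R) (b : I -> 'rV[R]_n) w :
  inner G (\sum_i k i *: b i) w = \sum_i k i * inner G (b i) w.
Proof.
rewrite /inner !mulmx_suml summxE; apply: eq_bigr => i _.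
by rewrite -!scalemxAl mxE.
Qed.

Lemma inner_orthonormal G m (p : nat) (b : m.-tuple 'rV[R]_n) (k : 'I_m -> R) j :
  (forall i j, inner G (tnth b i) (tnth b j) = (-1) ^+ (p <= i)%N *+ (i == j)) ->
  inner G (\sum_i k i *: tnth b i) (tnth b j) = k j * (-1) ^+ (p <= j)%N.
Proof.
move=> ob; rewrite inner_comb (bigD1 j)//= ob eqxx mulr1n big1 ?addr0// => i ij.
by rewrite ob (negbTE ij) mulr0n mulr0.
Qed.

(** Pairing with a basis vector returns the coordinate up to sign, and some coordinate of [x] is
    nonzero. *)
Lemma signature_nondegenerate G p q : has_signature G fullv p q ->
  forall x, x != 0 -> exists y, inner G x y != 0.
Proof.
move=> [b [/andP[/eqP sb _] ob]] x x0.
have xE : x = \sum_i coord b i x *: tnth b i.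
  rewrite {1}(@coord_span _ _ _ b x) ?sb ?memvf//.
  by apply: eq_bigr => i _; rewrite (tnth_nth 0).
have [i xi|x_eq0] := pickP (fun i => coord b i x != 0).
  exists (tnth b i); rewrite {1}xE (inner_orthonormal _ _ ob).
  by rewrite mulf_neq0// signr_eq0.
case/eqP: x0; rewrite xE big1// => i _.
by have /eqP -> := negbFE (x_eq0 i); rewrite scale0r.
Qed.

Lemma signature_unitmx G p q : has_signature G fullv p q -> G \in unitmx.
Proof.
move=> /signature_nondegenerate nd; rewrite unitmxE unitfE.
apply/negP => /det0P[v v0 vG]; have [y] := nd v v0.
by rewrite /inner vG mul0mx mxE eqxx.
Qed.

(** Orthonormal vectors are free: pairing a vanishing combination with each of them isolates its
    coefficient up to sign. *)
Lemma signature_span G p q (b : (p + q).-tuple 'rV[R]_n) :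
  (forall i j, inner G (tnth b i) (tnth b j) = (-1) ^+ (p <= i)%N *+ (i == j)) ->
  has_signature G <<b>> p q.
Proof.
move=> ob; exists b; split => //; rewrite basisEfree subvv /= andbC size_tuple.
suff fb : free b by rewrite fb (eqP fb) size_tuple leqnn.
apply/freeP => k k0 i; have := inner_orthonormal k i ob.
under eq_bigr do rewrite (tnth_nth 0).
rewrite k0 /inner !mul0mx mxE => /esym/eqP.
by rewrite mulf_eq0 signr_eq0 orbF => /eqP.
Qed.

Lemma lorentz_frame_of G V : G^T = G -> lorentz_or_antilorentz G V ->
  exists s e1 e2 e3, [/\ s = 1 \/ s = -1, lorentz_frame (inner G) s e1 e2 e3 &
    forall v, v \in V -> in_span e1 e2 e3 v].
Proof.
move=> /inner_inner_like[_ Is].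
have span3 (b : 3.-tuple 'rV[R]_n) v : basis_of V b -> v \in V ->
    exists a : 'I_3 -> R,
      v = a 0 *: tnth b 0 + (a 1 *: tnth b 1 + a 2%:R *: tnth b 2%:R).
  move=> /andP[/eqP sb _]; rewrite -sb => /coord_span vE.
  exists (fun i => coord b i v); rewrite {1}vE !big_ord_recl big_ord0 addr0.
  rewrite (_ : lift ord0 ord0 = 1 :> 'I_3); last exact: val_inj.
  rewrite (_ : lift ord0 (lift ord0 ord0) = 2%:R :> 'I_3); last exact: val_inj.
  by rewrite !(tnth_nth 0).
move=> [[b [bV ob]]|[b [bV ob]]].
- exists 1, (tnth b 0), (tnth b 1), (tnth b 2%:R); split; first by left.
    by split; split; rewrite ob.
  move=> v /(span3 b v bV)[a ->].
  by exists (a 0), (a 1), (a 2%:R).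
(* In signature (1,2) the basis lists its positive vector first, while the frame wants the vector of
   odd sign last. *)
- exists (-1), (tnth b 1), (tnth b 2%:R), (tnth b 0); split; first by right.
    by split; split; rewrite ob ?opprK.
  move=> v /(span3 b v bV)[a ->].
  by exists (a 1), (a 2%:R), (a 0); rewrite /comb addrC -addrA.
Qed.

Lemma lorentz_frame_span G s e1 e2 e3 : G^T = G -> s = 1 \/ s = -1 ->
  lorentz_frame (inner G) s e1 e2 e3 ->
  exists2 V, lorentz_or_antilorentz G V & forall v, in_span e1 e2 e3 v -> v \in V.
Proof.
move=> /inner_inner_like[_ Is] s1 [[I11 I22 I33] [I12 I13 I23]].
have mem (X : seq 'rV[R]_n) v : e1 \in X -> e2 \in X -> e3 \in X ->
    in_span e1 e2 e3 v -> v \in <<X>>%VS.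
  move=> X1 X2 X3 [a1 [a2 [a3 ->]]].
  by rewrite /comb !memvD// memvZ// memv_span.
case: s1 => sE; rewrite sE in I11 I22 I33.
- exists <<[tuple e1; e2; e3] : (2 + 1).-tuple _>>%VS; last first.
    by move=> v; apply: mem; rewrite !inE eqxx ?orbT.
  left; apply: signature_span => -[[|[|[|//]]] i] [[|[|[|//]]] j];
    rewrite !(tnth_nth 0) //=;
    by rewrite ?I11 ?I22 ?I33 ?I12 ?I13 ?I23 // Is ?I12 ?I13 ?I23.
- exists <<[tuple e3; e1; e2] : (1 + 2).-tuple _>>%VS; last first.
    by move=> v; apply: mem; rewrite !inE eqxx ?orbT.
  right; apply: signature_span => -[[|[|[|//]]] i] [[|[|[|//]]] j];
    rewrite !(tnth_nth 0) //=;
    by rewrite ?I11 ?I22 ?I33 ?I12 ?I13 ?I23 ?opprK // Is ?I12 ?I13 ?I23.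
Qed.

Lemma null_ge0_iff G p q T : G^T = G -> has_signature G fullv p q ->
  curvature_like T ->
  null_ge0 (inner G) T <->
  forall V, lorentz_or_antilorentz G V -> exists K, forall v w,
    v \in V -> w \in V -> K * area2 G v w <= T v w v w.
Proof.
move=> Gs sG T_curv; have I_inner := inner_inner_like Gs; split=> [T0 V|H].
  move=> /(lorentz_frame_of Gs)[s [e1 [e2 [e3 [s1 fr VE]]]]].
  have s2 : s ^+ 2 = 1 by case: s1 => ->; rewrite ?sqrrN expr1n.
  have [K HK] := null_ge0_bound I_inner T_curv s2 fr T0.
  by exists K => v w /VE ve /VE we; apply: HK.
have bound s : s = 1 \/ s = -1 -> curvature_bound (inner G) T s.
  move=> s1 e1 e2 e3 fr; have [V LV VE] := lorentz_frame_span Gs s1 fr.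
  by have [K HK] := H V LV; exists K => v w /VE vV /VE wV; apply: HK.
apply: curvature_bound_null_ge0 => //; last 2 first.
- by apply: bound; left.
- by apply: bound; right.
exact: signature_nondegenerate sG.
Qed.

End Frames.

(** * From charts to the manifold *)

Lemma curvature_curvature_like (R : realType) n (U : set 'rV[R]_n)
    (g : 'rV[R]_n -> 'M[R]_n) x : open U -> smooth_on U g ->
  (forall y, U y -> (g y)^T = g y) -> (forall y, U y -> g y \in unitmx) -> U x ->
  curvature_like (curvature g x).
Proof.
move=> oU sg gs gu Ux; split => [b c d t a a'|a c d t b b'|a b d t c c'|
    a b c t d d'|a c d|a b c].
1-4: rewrite !curvatureE;
  do 4![rewrite mulr_sumr -big_split; apply: eq_bigr => ? _ /=];
  by rewrite !mxE; ring.
- exact: curvature_antisym12.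
- exact: curvature_antisym34 Ux.
Qed.

Theorem proposition6p2 (R : realType) (n : nat)
  (M : semiRiemannianManifold R n) (M_indefinite : indefinite M) :
  (Rnull_ge0 M <-> RV_ge M) /\ (Rnull_le0 M <-> RV_le M).
Proof.
have curv (p : M) c : dom (atlas c) p -> curvature_like (curvature_at c p).
  move=> cp; rewrite /curvature_at.
  apply: (@curvature_curvature_like _ _ (Defs.coord (atlas c) @` dom (atlas c))).
  - exact: image_open.
  - exact: metric_smooth.
  - by move=> _ [r cr <-]; exact: Defs.metric_sym cr.
  - by move=> _ [r cr <-]; apply: signature_unitmx (metric_signature cr).
  - by exists p.
(* Both conditions are tested point by point and chart by chart, so the algebraic equivalence
   applies in each tangent space. *)
have iff_at (p : M) c (cp : dom (atlas c) p) T :=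
  @null_ge0_iff _ _ (metric_at c p) _ _ T (Defs.metric_sym cp) (metric_signature cp).
split; split => H p c cp.
- by apply: (iff_at p c cp _ (curv p c cp)).1 => x v x0 xx; apply: (H p c cp).
- move=> x v [x0 xx] v0 vx.
  exact: (iff_at p c cp _ (curv p c cp)).2 (H p c cp) x v x0 xx v0 vx.
(* For the reversed signs the equivalence is applied to the negated curvature, and the multiplier
   changes sign with it. *)
- move=> V LV; have [|K HK] :=
    (iff_at p c cp _ (curvature_likeN (curv p c cp))).1 _ V LV.
    by move=> x v x0 xx v0 vx; rewrite oppr_ge0; apply: (H p c cp).
  by exists (- K) => v w vV wV; rewrite mulNr lerNr; apply: HK.
- move=> x v [x0 xx] v0 vx; rewrite -oppr_ge0.
  apply: (iff_at p c cp _ (curvature_likeN (curv p c cp))).2 => // V LV.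
  have [K HK] := H p c cp V LV; exists (- K) => a b aV bV.
  by rewrite mulNr lerN2; apply: HK.
Qed.
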